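(* Let $s\in(0,1)$, $n\geq1$, and let $\Omega\subset\mathbb{R}^n$ be a nonempty bounded open set. For $k\in\mathbb{N}$ let $\Omega^k=\Omega\times(-k,k)$ and let $\Omega^\infty=\Omega\times\mathbb{R}\subset\mathbb{R}^{n+1}$. (a) Let $E\subset\mathbb{R}^{n+1}$ be such that $$\Omega\times(-\infty,-k]\subset E\cap\Omega^\infty\subset\Omega\times(-\infty,k]$$ for some $k\in\mathbb{N}$, and suppose that $P_s(E,\Omega^{k+1})<\infty$. Then $P_s^L(E,\Omega^\infty)<\infty$. (b) On the other hand, if $E\subset\mathbb{R}^{n+1}$ satisfies $$\{x_{n+1}\leq-k\}\subset E\subset\{x_{n+1}\leq k\}$$ for some $k\in\mathbb{N}$, then $P_s^{NL}(E,\Omega^\infty)=\infty$. (c) In particular, if $\Omega$ has $C^{1,1}$ boundary and $v\in L^\infty(\mathbb{R}^n)$, there does not exist a set $E\subset\mathbb{R}^{n+1}$ which is $s$-minimal in $\Omega^\infty$ with exterior data $$E\setminus\Omega^\infty=\{(x,t)\in\mathbb{R}^{n+1}\ |\ x\in\mathbb{R}^n\setminus\Omega,\ t<v(x)\}.$$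
   Context: All sets are Lebesgue measurable; equalities and inclusions of sets are understood up to measure zero. In $\mathbb{R}^{n+1}$: for disjoint $A,B\subset\mathbb{R}^{n+1}$ put $\mathcal{L}_s(A,B)=\int_A\int_B\frac{dX\,dY}{|X-Y|^{n+1+s}}\in[0,\infty]$. For $E\subset\mathbb{R}^{n+1}$ and an open set $U\subset\mathbb{R}^{n+1}$, writing $E^c=\mathbb{R}^{n+1}\setminus E$, $$P_s^L(E,U)=\mathcal{L}_s(E\cap U,E^c\cap U),\qquad P_s^{NL}(E,U)=\mathcal{L}_s(E\cap U,E^c\setminus U)+\mathcal{L}_s(E\setminus U,E^c\cap U),$$ and $P_s(E,U)=P_s^L(E,U)+P_s^{NL}(E,U)$. $E$ is $s$-minimal in $U$ if $P_s(E,U)<\infty$ and $P_s(E,U)\leq P_s(F,U)$ for every $F\subset\mathbb{R}^{n+1}$ with $F\setminus U=E\setminus U$. Points of $\mathbb{R}^{n+1}$ are written $(x,x_{n+1})$ with $x\in\mathbb{R}^n$. *)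

(* Defs.v *)
From HB Require Import structures.
From mathcomp Require Import all_boot all_order all_algebra.
From mathcomp Require Import all_classical all_reals all_analysis.
From mathcomp Require Import ess_sup_inf.

Set Implicit Arguments.
Unset Strict Implicit.
Unset Printing Implicit Defensive.

Import Order.TTheory GRing.Theory Num.Theory.
Import numFieldNormedType.Exports.

Local Open Scope classical_set_scope.
Local Open Scope ring_scope.

(* Borel sigma-algebra on row vectors, generated by the coordinate maps (as the
   library does for n.-tuple T). *)
Definition measure_row_display : measure_display. Proof. exact. Qed.

Section measurable_row.
Variables (R : realType) (n : nat).

Let coors : 'I_n -> 'rV[R]_n -> R := fun i x => x ord0 i.

Let row_set0 : g_sigma_preimage coors set0.
Proof. exact: sigma_algebra0. Qed.

Let row_setC A : g_sigma_preimage coors A -> g_sigma_preimage coors (~` A).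
Proof. exact: sigma_algebraC. Qed.

Let row_bigcup (F : (set 'rV[R]_n)^nat) :
  (forall i, g_sigma_preimage coors (F i)) ->
  g_sigma_preimage coors (\bigcup_i (F i)).
Proof. exact: sigma_algebra_bigcup. Qed.

HB.instance Definition _ := @isMeasurable.Build measure_row_display
  'rV[R]_n (g_sigma_preimage coors) row_set0 row_setC row_bigcup.

Definition row_of_tuple (t : n.-tuple R) : 'rV[R]_n := \row_i tnth t i.
Definition tuple_of_row (x : 'rV[R]_n) : n.-tuple R := [tuple x ord0 i | i < n].

Lemma row_of_tupleK : cancel row_of_tuple tuple_of_row.
Proof. by move=> t; apply: eq_from_tnth => i; rewrite tnth_mktuple mxE. Qed.

Lemma measurable_coord (i : 'I_n) :
  measurable_fun [set: 'rV[R]_n] (fun x : 'rV[R]_n => x ord0 i).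
Proof.
move=> _ Y mY; rewrite setTI; apply: sub_sigma_algebra => /=.
rewrite -bigcup_seq/=; exists i => /=; first by rewrite mem_index_enum.
by exists Y => //; rewrite setTI.
Qed.

Lemma measurable_tuple_of_row : measurable_fun setT tuple_of_row.
Proof.
apply/measurable_fun_tnthP => i.
rewrite (_ : _ \o _ = fun x : 'rV[R]_n => x ord0 i); last first.
  by apply/funext => x /=; rewrite tnth_mktuple.
exact: measurable_coord.
Qed.

Lemma measurable_row_of_tuple : measurable_fun setT row_of_tuple.
Proof.
move=> _ Y mY; rewrite setTI.
have : preimage_set_system setT row_of_tuple (g_sigma_preimage coors)
         (row_of_tuple @^-1` Y) by exists Y => //; rewrite setTI.
rewrite -g_sigma_preimage_comp.
rewrite (_ : (fun i => _) = (fun i => @tnth n R ^~ i)) //.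
by apply/funext => i; apply/funext => t /=; rewrite /coors mxE.
Qed.

End measurable_row.

(* The library's canonical sigma-finite structure on m1 \x m2 is restricted to
   subprobabilities; this alias has one for all sigma-finite m1 and m2. *)
Section sigma_finite_product.
Local Open Scope ereal_scope.
Context d1 d2 (T1 : measurableType d1) (T2 : measurableType d2) (R : realType).
Variable m1 : {sigma_finite_measure set T1 -> \bar R}.
Variable m2 : {sigma_finite_measure set T2 -> \bar R}.

Definition product_measure : set (T1 * T2) -> \bar R := m1 \x m2.

HB.instance Definition _ := Measure.on product_measure.

Let product_sigma_finite : sigma_finite setT product_measure.
Proof.
have /sigma_finiteP[F [TF ndF Foo]] := sigma_finiteT m1.
have /sigma_finiteP[G [TG ndG Goo]] := sigma_finiteT m2.
exists (fun k => F k `*` G k).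
  rewrite -setXTT TF TG predeqE => -[x y]; split.
    move=> [/= [k _ Fkx] [l _ Gly]]; exists (maxn k l) => //; split.
    - by move: x Fkx; exact/subsetPset/ndF/leq_maxl.
    - by move: y Gly; exact/subsetPset/ndG/leq_maxr.
  by move=> [k _ []/= ? ?]; split; exists k.
move=> k; have [? ?] := Foo k; have [? ?] := Goo k.
split; first exact: measurableX.
by rewrite /product_measure product_measure1E// lte_mul_pinfty// ge0_fin_numE.
Qed.

HB.instance Definition _ := Measure_isSigmaFinite.Build _ _ _
  product_measure product_sigma_finite.

End sigma_finite_product.

(* Pushforward of a sigma-finite measure along a measurable map with a
   measurable left inverse, which keeps it sigma-finite. *)
Section image_measure.
Local Open Scope ereal_scope.
Context d d' (T1 : measurableType d) (T2 : measurableType d') (R : realType).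
Variables (m : {sigma_finite_measure set T1 -> \bar R}).
Variables (f : T1 -> T2) (g : T2 -> T1).

Definition image_measure (mf : measurable_fun setT f)
    (mg : measurable_fun setT g) (fK : cancel f g) : set T2 -> \bar R :=
  pushforward m f.

Hypotheses (mf : measurable_fun setT f) (mg : measurable_fun setT g).
Hypothesis fK : cancel f g.

Let mu := image_measure mf mg fK.

Let mu0 : mu set0 = 0. Proof. exact: measure0. Qed.

Let mu_ge0 A : 0 <= mu A. Proof. exact: measure_ge0. Qed.

Let mu_sigma_additive : semi_sigma_additive mu.
Proof. exact: measure_semi_sigma_additive. Qed.

HB.instance Definition _ := isMeasure.Build _ _ _ (image_measure mf mg fK)
  mu0 mu_ge0 mu_sigma_additive.

Let mu_sigma_finite : sigma_finite setT mu.
Proof.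
have [F FT Foo] := sigma_finiteT m.
exists (fun i => g @^-1` F i); first by rewrite -preimage_bigcup -FT preimage_setT.
move=> i; have [mF moo] := Foo i; split.
  by rewrite -[X in measurable X]setTI; exact: mg.
rewrite /mu /image_measure /pushforward (_ : _ @^-1` _ = F i)//.
by apply/funext => x /=; rewrite fK.
Qed.

HB.instance Definition _ := Measure_isSigmaFinite.Build _ _ _
  (image_measure mf mg fK) mu_sigma_finite.

End image_measure.

Section lebesgue_row.
Local Open Scope ereal_scope.
Variable R : realType.

Definition cons_pair n (p : R * n.-tuple R) : n.+1.-tuple R :=
  [tuple of p.1 :: p.2].
Definition uncons_pair n (t : n.+1.-tuple R) : R * n.-tuple R :=
  (thead t, [tuple of behead t]).

Lemma cons_pairK n : cancel (@cons_pair n) (@uncons_pair n).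
Proof. by move=> [x t]; congr pair; apply/val_inj. Qed.

Lemma measurable_cons_pair n : measurable_fun setT (@cons_pair n).
Proof. exact: measurable_cons. Qed.

Lemma measurable_uncons_pair n : measurable_fun setT (@uncons_pair n).
Proof.
apply/measurable_fun_pairP; split; first exact: measurable_tnth.
exact: measurable_behead.
Qed.

(* lebesgue_measure lives on measurableTypeR R, which has the same measurable
   sets as R but another display. *)
Definition lebesgue_line : set R -> \bar R := @lebesgue_measure R.

Let line0 : lebesgue_line set0 = 0.
Proof. exact: (@measure0 _ _ _ (@lebesgue_measure R)). Qed.

Let line_ge0 A : 0 <= lebesgue_line A.
Proof. exact: (@measure_ge0 _ _ _ (@lebesgue_measure R)). Qed.

Let line_sigma_additive : semi_sigma_additive lebesgue_line.
Proof. exact: (@measure_semi_sigma_additive _ _ _ (@lebesgue_measure R)). Qed.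

HB.instance Definition _ := isMeasure.Build _ _ _ lebesgue_line
  line0 line_ge0 line_sigma_additive.

Let line_sigma_finite : sigma_finite setT lebesgue_line.
Proof. exact: (@sigma_finiteT _ _ _ (@lebesgue_measure R)). Qed.

HB.instance Definition _ := Measure_isSigmaFinite.Build _ _ _ lebesgue_line
  line_sigma_finite.

(* n-dimensional Lebesgue measure (on Borel sets): the n-fold product of the
   Lebesgue measure on the line; for n = 0, the unit mass at the point. *)
Fixpoint lebesgue_tuple n : {sigma_finite_measure set (n.-tuple R) -> \bar R} :=
  match n with
  | 0 => \d_([tuple] : 0.-tuple R)
  | n'.+1 => image_measure (product_measure lebesgue_line (lebesgue_tuple n'))
      (@measurable_cons_pair n') (@measurable_uncons_pair n') (@cons_pairK n')
  end.

Definition lebesgue_row n : {sigma_finite_measure set 'rV[R]_n -> \bar R} :=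
  image_measure (lebesgue_tuple n) (@measurable_row_of_tuple R n)
    (@measurable_tuple_of_row R n) (@row_of_tupleK R n).

(* R^(n+1) is 'rV[R]_n * R, with points (x, x_(n+1)). *)
Definition lebesgue_space n :
    {sigma_finite_measure set ('rV[R]_n * R)%type -> \bar R} :=
  product_measure (lebesgue_row n) lebesgue_line.

End lebesgue_row.

Section up_to_null_sets.
Context d (T : measurableType d) (R : realType).
Variable mu : {measure set T -> \bar R}.

(* Measurability for the completion of mu.  For mu = lebesgue_row n or
   lebesgue_space n, whose domains are the Borel sets, these are the Lebesgue
   measurable sets. *)
Definition completion_measurable (A : set T) : Prop :=
  exists2 B, measurable B & {ae mu, forall x, A x <-> B x}.

Definition ae_subset (A B : set T) : Prop := {ae mu, forall x, A x -> B x}.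

Definition ae_eqset (A B : set T) : Prop := {ae mu, forall x, A x <-> B x}.

End up_to_null_sets.

Section fractional_perimeter.
Local Open Scope ereal_scope.
Variables (R : realType) (n : nat) (s : R).
Local Notation space := ('rV[R]_n * R)%type.
Implicit Types A B E F U : set space.

Definition dist_space (X Y : space) : R :=
  Num.sqrt (\sum_(i < n) (X.1 ord0 i - Y.1 ord0 i) ^+ 2 + (X.2 - Y.2) ^+ 2)%R.

(* The value of the integrand at X = Y is 0, but it is only used for disjoint A
   and B.  For A, B completion measurable but not Borel, \int is a supremum over
   Borel simple functions below the integrand, which gives the integral with
   respect to the completed measure. *)
Definition interaction A B : \bar R :=
  \int[lebesgue_space R n]_(X in A) \int[lebesgue_space R n]_(Y in B)
    ((dist_space X Y `^ (n.+1%:R + s))^-1)%:E.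

Definition perimeter_local E U : \bar R := interaction (E `&` U) (~` E `&` U).

Definition perimeter_nonlocal E U : \bar R :=
  interaction (E `&` U) (~` E `\` U) + interaction (E `\` U) (~` E `&` U).

Definition perimeter E U : \bar R := perimeter_local E U + perimeter_nonlocal E U.

Definition s_minimal E U : Prop :=
  perimeter E U < +oo /\
  forall F, completion_measurable (lebesgue_space R n) F ->
    ae_eqset (lebesgue_space R n) (F `\` U) (E `\` U) ->
    perimeter E U <= perimeter F U.

End fractional_perimeter.

Section functions_and_domains.
Variables (R : realType) (n : nat).

(* v represents an element of L^oo(R^n) *)
Definition Linfty (v : 'rV[R]_n -> R) : Prop :=
  (forall B : set R, measurable B ->
     completion_measurable (lebesgue_row R n) (v @^-1` B)) /\
  (ess_sup (lebesgue_row R n) (fun x => `|v x|%:E) < +oo)%E.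

Definition C11 (g : 'rV[R]_n -> R) : Prop :=
  (forall x, differentiable g x) /\
  exists M : R, forall x y w, `|'d g x w - 'd g y w| <= M * `|x - y| * `|w|.

Definition dotrow (x y : 'rV[R]_n) : R := \sum_(i < n) x ord0 i * y ord0 i.

(* Near each boundary point, Omega is the part of a ball lying above a C^{1,1}
   graph in the direction of a unit vector nu.  The graph function is evaluated
   only on the hyperplane orthogonal to nu, which plays the role of R^(n-1); a
   C^{1,1} function on this hyperplane extends to R^n by composition with the
   orthogonal projection. *)
Definition C11_boundary (Omega : set 'rV[R]_n) : Prop :=
  forall x0, (closure Omega `\` interior Omega) x0 ->
  exists r (nu : 'rV[R]_n) (g : 'rV[R]_n -> R),
    [/\ 0 < r, dotrow nu nu = 1, C11 g &
        forall x, dotrow (x - x0) (x - x0) < r ^+ 2 ->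
          (Omega x <-> g (x - dotrow x nu *: nu) < dotrow x nu)].

Definition cylinder (Omega : set 'rV[R]_n) (k : nat) : set ('rV[R]_n * R) :=
  Omega `*` `]- k%:R, k%:R[%classic.

Definition infinite_cylinder (Omega : set 'rV[R]_n) : set ('rV[R]_n * R) :=
  Omega `*` setT.

End functions_and_domains.

(* Main.v *)
(* Both (b) and (c) hold because the nonlocal part diverges, whatever E is inside the
   cylinder.  Every point of Omega x ]-2T,-T[ is at distance O(T) from a region
   of volume T^(n+1) of the exterior of the cylinder contained in E, and from
   another one contained in the complement of E.  So, up to a constant, the
   nonlocal perimeter is at least |Omega| T * T^(n+1) * T^-(n+1+s)
   = |Omega| T^(1-s), for all large T.

   For (a), cut both E and its complement at height k+1: all interactions but
   the one between the two far ends of the cylinder are bounded by the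
   perimeter in Omega^(k+1).  For the far ends, |X - Y|^2 >= |x_(n+1)| |y_(n+1)|
   dominates the kernel by the product of two functions t^-q with
   q = (n+1+s)/2 > 1. *)

Require Import Defs.
From mathcomp Require Import all_boot all_order all_algebra.
From mathcomp Require Import all_classical all_reals all_analysis.
From mathcomp Require Import measurable_realfun ess_sup_inf lra ring.

Set Implicit Arguments.
Unset Strict Implicit.

Import Order.TTheory GRing.Theory Num.Theory.
Import numFieldNormedType.Exports.

Local Open Scope classical_set_scope.
Local Open Scope ring_scope.

(** * Integrals of nonnegative functions over sets that need not be measurable *)

Section lower_integral.
Local Open Scope ereal_scope.
Context {d} {T : measurableType d} {R : realType}.
Variable mu : {measure set T -> \bar R}.

Import HBNNSimple.

(* No measurability is required: \int is a supremum over measurable simple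
   functions, which can be cut off on a null set. *)
Lemma le_integral_ae (A B : set T) (f g : T -> \bar R) :
  (forall x, 0 <= f x) -> (forall x, 0 <= g x) ->
  {ae mu, forall x, A x -> B x /\ f x <= g x} ->
  \int[mu]_(x in A) f x <= \int[mu]_(x in B) g x.
Proof.
move=> f0 g0 [N [mN N0 fgN]].
rewrite integral_mkcond [leRHS]integral_mkcond.
have fA0 x : 0 <= (f \_ A) x by rewrite patchE; case: ifP.
have gB0 x : 0 <= (g \_ B) x by rewrite patchE; case: ifP.
rewrite ge0_integralTE// [leRHS]ge0_integralTE//.
apply: ge_ereal_sup => _ [h /= hf <-].
have mNC : measurable (~` N) by exact: measurableC.
pose h' := mul_nnsfun h (indic_nnsfun R mNC).
have h'E x : h' x = (h x * \1_(~` N) x)%R by [].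
apply: le_ereal_sup_tmp; exists (sintegral mu h').
  suff h'g x : (h' x)%:E <= (g \_ B) x by exists h'.
  rewrite h'E; have [xN|xN] := boolP (x \in ~` N); last first.
    by rewrite indicE (negbTE xN) mulr0.
  rewrite indicE xN mulr1; apply: (le_trans (hf x)).
  rewrite [leLHS]patchE; case: ifPn => // xA; have Ax := set_mem xA.
  have : ~ ~ (A x -> B x /\ f x <= g x).
    by move=> /fgN; rewrite inE in xN.
  by move=> /contrapT/(_ Ax)[Bx fg]; rewrite patchE mem_set.
rewrite -!integralT_nnsfun.
apply: ae_ge0_le_integral => //.
- by move=> x _; rewrite lee_fin.
- exact/measurable_EFinP.
- by move=> x _; rewrite lee_fin.
- exact/measurable_EFinP.
exists N; split=> // x; apply: contra_notP => xN _.
have <- : h' x = h x by rewrite h'E indicE mem_set// mulr1.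
exact: lexx.
Qed.

(** The sets may overlap: the union is split into [A] and the part of [B] off [A], and enlarging
    that part back to [B] costs nothing for [f] nonnegative. *)
Lemma le_integral_setU (A B : set T) (f : T -> \bar R) :
  measurable A -> measurable B -> measurable_fun setT f ->
  (forall x, 0 <= f x) ->
  \int[mu]_(x in A `|` B) f x <=
    \int[mu]_(x in A) f x + \int[mu]_(x in B) f x.
Proof.
move=> mA mB mf f0.
have mAB : measurable (B `\` A) by exact: measurableD.
rewrite (_ : A `|` B = A `|` (B `\` A)); last first.
  by rewrite setDE setUIr setUv setIT.
rewrite ge0_integral_setU//; last 2 first.
- exact: measurable_funTS.
- by apply/disj_setPS => x [Ax []].
apply: leeD2l; apply: le_integral_ae => //.
by apply: aeW => x [].
Qed.

End lower_integral.

(** * Open sets and balls of R^n as Borel sets *)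

Section row_space.
Context {R : realType} {n : nat}.

Lemma measurable_row_box (J : 'I_n -> set R) : (forall i, measurable (J i)) ->
  measurable [set x : 'rV[R]_n | forall i, J i (x ord0 i)].
Proof.
move=> mJ.
rewrite (_ : [set _ | _] =
  \bigcap_(i in setT) ((fun x : 'rV[R]_n => x ord0 i) @^-1` J i)).
  apply: fin_bigcap_measurable => // i _.
  rewrite -[X in measurable X]setTI.
  exact: measurable_coord.
by apply/seteqP; split=> x /= h i; [move=> _|]; exact: h.
Qed.

(** The sigma-algebra is generated by the coordinates, so [U] is written as the union of those open
    cubes inside it that have rational centre and half-side 1/(m+1): there are countably many. *)
Lemma open_measurable_row (U : set 'rV[R]_n) : open U -> measurable U.
Proof.
move=> oU.
pose box (q : 'rV[rat]_n * nat) : set 'rV[R]_n :=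
  [set x | forall i, `](ratr (q.1 ord0 i) - q.2.+1%:R^-1 : R),
     ratr (q.1 ord0 i) + q.2.+1%:R^-1[%classic (x ord0 i)].
pose F q := if pselect (box q `<=` U) then box q else set0.
rewrite (_ : U = \bigcup_q F q).
  apply: countable_bigcupT_measurable => // q.
  rewrite /F; case: pselect => //= _.
  pose J i : set R := `](ratr (q.1 ord0 i) - q.2.+1%:R^-1),
    (ratr (q.1 ord0 i) + q.2.+1%:R^-1)[%classic.
  by apply: (measurable_row_box (J := J)) => i; exact: measurable_itv.
apply/seteqP; split=> [x Ux|x [q _]]; last first.
  by rewrite /F; case: pselect => //; exact.
move: oU; rewrite openE => /(_ x Ux)/nbhs_ballP[e /= e0 xeU].
(* The rational centre is within 1/(m+1) of [x], so the cube stays within 2/(m+1) < e of [x]. *)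
have [m me] : exists m : nat, (m.+1%:R^-1 < e / 2 :> R).
  have /ltr_add_invr[m] : 0 < e / 2 by rewrite divr_gt0.
  by rewrite add0r; exists m.
have m0 : 0 < m.+1%:R^-1 :> R by rewrite invr_gt0.
have /choice[q qP] i : exists q : rat,
    ratr q \in `](x ord0 i - m.+1%:R^-1), (x ord0 i + m.+1%:R^-1)[.
  by apply: rat_in_itvoo; rewrite ltrBlDr -addrA ltrDl addr_gt0.
exists (\row_i q i, m) => //; rewrite /F; case: pselect => [? |[]].
  move=> i /=; rewrite mxE in_itv/=; have := qP i; rewrite in_itv/=.
  by move: (m.+1%:R^-1 : R) => r /andP[? ?]; apply/andP; split; lra.
move=> y ym; apply: xeU; split=> // j i; rewrite (ord1 j) /ball/=.
have := ym i; have := qP i; rewrite /= mxE !in_itv/= ltr_norml.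
by move: (m.+1%:R^-1 : R) me => r re /andP[? ?] /andP[? ?]; apply/andP; split; lra.
Qed.

(** Row vectors carry the maximum norm, so balls are cubes. *)
Lemma ball_row_box (x : 'rV[R]_n) (e : R) : 0 < e ->
  ball x e =
  [set y | forall i, `](x ord0 i - e), (x ord0 i + e)[%classic (y ord0 i)].
Proof.
move=> e0; apply/seteqP; split=> y /=.
  move=> [_ h] i; have := h ord0 i; rewrite /ball/= in_itv/= ltr_norml.
  by move=> /andP[? ?]; apply/andP; split; lra.
move=> h; split=> // j i; rewrite (ord1 j).
have := h i; rewrite /ball/= in_itv/= ltr_norml.
by move=> /andP[? ?]; apply/andP; split; lra.
Qed.

End row_space.

(** * Lebesgue measure of boxes, open sets and bounded sets *)

Section box_measure.
Local Open Scope ereal_scope.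
Context {R : realType}.

Lemma measurable_tuple_box n (J : 'I_n -> set R) :
  (forall i, measurable (J i)) ->
  measurable [set t : n.-tuple R | forall i, J i (tnth t i)].
Proof.
move=> mJ.
rewrite (_ : [set _ | _] =
  \bigcap_(i in setT) ((fun t : n.-tuple R => tnth t i) @^-1` J i)).
  apply: fin_bigcap_measurable => // i _.
  rewrite -[X in measurable X]setTI.
  exact: measurable_tnth.
by apply/seteqP; split=> x /= h i; [move=> _|]; exact: h.
Qed.

Lemma lebesgue_tuple_box n (J : 'I_n -> set R) :
  (forall i, measurable (J i)) ->
  lebesgue_tuple R n [set t : n.-tuple R | forall i, J i (tnth t i)] =
  \prod_(i < n) lebesgue_line (J i).
Proof.
elim: n J => [|n IH] J mJ.
  rewrite big_ord0 /= diracE mem_set//.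
  by case.
rewrite big_ord_recl -IH; last by move=> i.
rewrite /= /image_measure/= /pushforward.
rewrite -product_measure1E//; last first.
  exact: (measurable_tuple_box (J := fun i => J (lift ord0 i))).
rewrite /product_measure; congr (_ _).
apply/seteqP; split=> -[x t] /=.
  move=> h; split; first exact: (h ord0).
  by move=> i; have := h (lift ord0 i); rewrite tnthS.
move=> [Jx h] i; have [j ->|->//] := unliftP ord0 i.
by rewrite tnthS; exact: h.
Qed.

Lemma lebesgue_row_box n (J : 'I_n -> set R) : (forall i, measurable (J i)) ->
  lebesgue_row R n [set x : 'rV[R]_n | forall i, J i (x ord0 i)] =
  \prod_(i < n) lebesgue_line (J i).
Proof.
move=> mJ; rewrite -lebesgue_tuple_box// /lebesgue_row/= /image_measure/=.
rewrite /pushforward; congr (_ _); apply/seteqP; split=> t /= h i.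
  by have := h i; rewrite mxE.
by rewrite mxE; exact: h.
Qed.

Lemma lebesgue_row_cube n (a b : 'I_n -> R) (l : R) :
  (0 < l)%R -> (forall i, b i = a i + l)%R ->
  lebesgue_row R n
    [set x : 'rV[R]_n | forall i, `](a i), (b i)[%classic (x ord0 i)] =
  (l ^+ n)%:E.
Proof.
move=> l0 bE; rewrite (lebesgue_row_box (J := fun i => `](a i), (b i)[%classic))//.
rewrite (eq_bigr (fun=> l%:E)); last first.
  move=> i _; rewrite /lebesgue_line lebesgue_measure_itv/= bE lte_fin.
  by rewrite ltrDl l0 -EFinB addrAC subrr add0r.
by rewrite prodEFin prodr_const card_ord.
Qed.

Lemma lebesgue_row_ball n (x : 'rV[R]_n) (e : R) : (0 < e)%R ->
  lebesgue_row R n (ball x e) = ((e *+ 2) ^+ n)%:E.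
Proof.
move=> e0; rewrite ball_row_box//; apply: lebesgue_row_cube.
  by rewrite pmulrn_rgt0.
by move=> i; rewrite mulr2n addrA subrK.
Qed.

Lemma lebesgue_row_open_gt0 n (U : set 'rV[R]_n) :
  open U -> U !=set0 -> 0 < lebesgue_row R n U.
Proof.
move=> oU [x Ux]; have mU := open_measurable_row oU.
move: oU; rewrite openE => /(_ x Ux)/nbhs_ballP[e /= e0 xeU].
apply: (@lt_le_trans _ _ (lebesgue_row R n (ball x e))).
  by rewrite lebesgue_row_ball// lte_fin exprn_gt0// pmulrn_rgt0.
apply: le_measure => //; rewrite inE//.
by apply: open_measurable_row; exact: ball_open.
Qed.

Lemma bounded_set_row_ball n (U : set 'rV[R]_n) : bounded_set U ->
  exists2 M : R, (0 < M)%R & U `<=` ball (0 : 'rV[R]_n)%R M.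
Proof.
(* [UM] bounds the norm on [U] by any number strictly above [M], here |M| + 1; the ball is open,
   hence one more unit. *)
move=> [M [_ UM]]; exists (`|M| + 2)%R; first by rewrite ltr_wpDl.
move=> x /UM xM.
rewrite -ball_normE/= sub0r normrN.
apply: (@le_lt_trans _ _ (`|M| + 1)%R); last by rewrite ltrD2l ltr1n.
by apply: xM; rewrite (le_lt_trans (ler_norm _))// ltrDl.
Qed.

Lemma lebesgue_row_bounded_lty n (U : set 'rV[R]_n) :
  measurable U -> bounded_set U -> lebesgue_row R n U < +oo.
Proof.
move=> mU /bounded_set_row_ball[M M0 UM].
apply: (@le_lt_trans _ _ (lebesgue_row R n (ball (0 : 'rV[R]_n)%R M))).
  apply: le_measure => //; rewrite inE//.
  by apply: open_measurable_row; exact: ball_open.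
by rewrite lebesgue_row_ball// ltry.
Qed.

End box_measure.

(** * Measurability, monotonicity, subadditivity and a lower bound for the interaction *)

Section interaction_theory.
Local Open Scope ereal_scope.
Context {R : realType} {n : nat} {s : R}.
Local Notation space := ('rV[R]_n * R)%type.
Local Notation mu := (lebesgue_space R n).
Local Notation kernel X Y := (((dist_space X Y `^ (n.+1%:R + s))^-1)%:E).
Implicit Types A B : set space.

Lemma dist_space_ge0 (X Y : space) : (0 <= dist_space X Y)%R.
Proof. exact: sqrtr_ge0. Qed.

Lemma kernel_ge0 (X Y : space) : 0 <= kernel X Y.
Proof. by rewrite lee_fin invr_ge0 powR_ge0. Qed.

Lemma sqr_dist_space (X Y : space) : (dist_space X Y ^+ 2 =
  \sum_(i < n) (X.1 ord0 i - Y.1 ord0 i) ^+ 2 + (X.2 - Y.2) ^+ 2)%R.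
Proof.
rewrite /dist_space sqr_sqrtr// addr_ge0 ?sqr_ge0// sumr_ge0// => i _.
exact: sqr_ge0.
Qed.

Lemma measurable_kernel :
  measurable_fun setT (fun Z : space * space => kernel Z.1 Z.2).
Proof.
apply/measurable_EFinP.
under eq_fun do rewrite -powRN.
apply: (measurableT_comp (measurable_powR _)).
apply: (@measurableT_comp _ _ _ _ _ _ (@Num.sqrt R)).
  by apply: continuous_measurable_fun; exact: sqrt_continuous.
apply: measurable_funD.
  apply: measurable_sum => i; apply: measurable_funX; apply: measurable_funB.
    apply: (measurableT_comp (measurable_coord i) (g := fun Z => Z.1.1)).
    exact: measurableT_comp.
  apply: (measurableT_comp (measurable_coord i) (g := fun Z => Z.2.1)).
  exact: measurableT_comp.
apply: measurable_funX; apply: measurable_funB.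
  exact: measurableT_comp.
exact: measurableT_comp.
Qed.

Lemma measurable_kernelr X : measurable_fun setT (fun Y : space => kernel X Y).
Proof.
exact: (measurableT_comp measurable_kernel (measurable_pair1 X)).
Qed.

(** Tonelli's theorem, for the kernel replaced by 0 where the second point is off [B]. *)
Lemma measurable_kernel_int B : measurable B ->
  measurable_fun setT (fun X => \int[mu]_(Y in B) kernel X Y).
Proof.
move=> mB.
pose f := (fun Z : space * space => kernel Z.1 Z.2) \_ (snd @^-1` B).
have mf : measurable_fun setT f.
  apply/(measurable_restrictT _ _).1; last exact: measurable_funTS measurable_kernel.
  by rewrite -[X in measurable X]setTI; exact: measurable_snd.
have f0 Z : 0 <= f Z by rewrite /f patchE; case: ifP => // _; exact: kernel_ge0.
have := measurable_fun_fubini_tonelli_F (m2 := mu) f mf f0.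
apply: eq_measurable_fun => X _; rewrite /fubini_F [RHS]integral_mkcond.
by apply: eq_integral => Y _; rewrite /f !patchE.
Qed.

Lemma interaction_ge0 A B : 0 <= interaction s A B.
Proof.
by apply: integral_ge0 => X _; apply: integral_ge0 => Y _; exact: kernel_ge0.
Qed.

(** Stated for arbitrary sets, so that a set measurable only for the completion can be exchanged for
    a Borel representative. *)
Lemma le_interaction_ae A A' B B' :
  ae_subset mu A A' -> ae_subset mu B B' ->
  interaction s A B <= interaction s A' B'.
Proof.
rewrite /ae_subset => AA' BB'; apply: le_integral_ae.
- by move=> X; apply: integral_ge0 => Y _; exact: kernel_ge0.
- by move=> X; apply: integral_ge0 => Y _; exact: kernel_ge0.
apply: filterS AA' => X AA' AX; split; first exact: AA'.
apply: le_integral_ae; [exact: kernel_ge0|exact: kernel_ge0|].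
by apply: filterS BB' => Y BB' BY; split; [exact: BB'|].
Qed.

Lemma interaction_setUl A A' B :
  measurable A -> measurable A' -> measurable B ->
  interaction s (A `|` A') B <= interaction s A B + interaction s A' B.
Proof.
move=> mA mA' mB; apply: le_integral_setU => //.
  exact: measurable_kernel_int.
by move=> X; apply: integral_ge0 => Y _; exact: kernel_ge0.
Qed.

Lemma interaction_setUr A B B' :
  measurable A -> measurable B -> measurable B' ->
  interaction s A (B `|` B') <= interaction s A B + interaction s A B'.
Proof.
move=> mA mB mB'; rewrite -ge0_integralD//; last 4 first.
- by move=> X _; apply: integral_ge0 => Y _; exact: kernel_ge0.
- by apply: measurable_funTS; exact: measurable_kernel_int.
- by move=> X _; apply: integral_ge0 => Y _; exact: kernel_ge0.
- by apply: measurable_funTS; exact: measurable_kernel_int.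
apply: le_integral_ae.
- by move=> X; apply: integral_ge0 => Y _; exact: kernel_ge0.
- by move=> X; apply: adde_ge0; apply: integral_ge0 => Y _; exact: kernel_ge0.
apply: aeW => X AX; split=> //; apply: le_integral_setU => //.
  exact: measurable_kernelr.
exact: kernel_ge0.
Qed.

(** The distance is bounded away from 0 in the hypothesis because, for a positive exponent, the
    kernel has the default value 0 at coinciding points. *)
(** The left-hand side is the double integral of the constant smallest value of the kernel. *)
Lemma interaction_ge A B (D : R) : measurable A -> measurable B ->
  (0 <= n.+1%:R + s)%R ->
  (forall X Y, A X -> B Y -> 0 < dist_space X Y <= D)%R ->
  ((D `^ (n.+1%:R + s))^-1)%:E * (mu A * mu B) <= interaction s A B.
Proof.
move=> mA mB p0 AB.
pose c := ((D `^ (n.+1%:R + s))^-1)%R.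
have c0 : (0 <= c)%R by rewrite invr_ge0 powR_ge0.
have -> : c%:E * (mu A * mu B) = \int[mu]_(X in A) \int[mu]_(Y in B) c%:E.
  rewrite (eq_integral (cst (c%:E * mu B))).
    by rewrite integral_cst// [mu A * _]muleC muleA.
  by move=> X _; exact: (integral_cst mu mB c%:E).
apply: le_integral_ae.
- by move=> X; apply: integral_ge0.
- by move=> X; apply: integral_ge0 => Y _; exact: kernel_ge0.
apply: aeW => X AX; split=> //; apply: le_integral_ae => //.
  exact: kernel_ge0.
apply: aeW => Y BY; split=> //; rewrite lee_fin.
have /andP[d0 dD] := AB _ _ AX BY.
rewrite lef_pV2 ?posrE ?powR_gt0//; last exact: lt_le_trans dD.
by apply: ge0_ler_powR => //; rewrite nnegrE; apply/ltW => //; exact: lt_le_trans dD.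
Qed.

End interaction_theory.

(** * Convergence of the integral of t^(-q) at infinity *)

Section power_tail.
Context {R : realType}.
Implicit Types (q t : R).

Lemma powRN_cvgy q : (0 < q) -> (t `^ (- q) @[t --> +oo] --> (0 : R)).
Proof.
move=> q0; apply/cvgrPdist_lt => e e0; near=> t.
have t0 : (0 < t) by near: t; exact: nbhs_pinfty_gt.
rewrite sub0r normrN ger0_norm ?powR_ge0// powRN.
rewrite -[ltRHS]invrK ltf_pV2 ?posrE ?invr_gt0 ?powR_gt0//.
(* The threshold for [t] is thus e^(-1/q). *)
have -> : (e^-1 = (e^-1 `^ q^-1) `^ q).
  by rewrite -powRrM mulVf ?gt_eqF// powRr1// invr_ge0 ltW.
apply: gt0_ltr_powR; [exact: q0|by rewrite nnegrE powR_ge0|by rewrite nnegrE ltW|].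
by near: t; exact: nbhs_pinfty_gt.
Unshelve. all: end_near. Qed.

Lemma continuous_powR_gt0 q t : (0 < t) -> {for t, continuous (@powR R ^~ q)}.
Proof.
move=> t0; apply: differentiable_continuous; apply/derivable1_diffP.
exact: (@ex_derive _ _ _ _ _ _ _ (is_derive1_powR q t0)).
Qed.

(** The antiderivative t^(1-q)/(1-q) tends to 0 at infinity because [1 < q], so the fundamental
    theorem of calculus on a half-line applies. *)
Lemma integral_powR_lty q : (1 < q) ->
  (\int[lebesgue_measure]_(t in `[1%R, +oo[) (t `^ (- q))%:E < +oo)%E.
Proof.
move=> q1.
have q10 : (1 - q != 0) by rewrite subr_eq0 lt_eqF.
have dF t : (0 < t) -> is_derive t 1
    ((1 - q)^-1 \*: (@powR R ^~ (1 - q)) : R -> R) (t `^ (- q)).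
  move=> t0; apply: is_derive_eq.
    by apply: is_deriveZ; exact: is_derive1_powR.
  rewrite /GRing.scale/= mulrA mulVf// mul1r.
  by congr (_ `^ _); rewrite addrAC subrr sub0r.
have cF t : (0 < t) -> {for t, continuous
    ((1 - q)^-1 \*: (@powR R ^~ (1 - q)) : R -> R)}.
  move=> t0; apply: differentiable_continuous; apply/derivable1_diffP.
  exact: (@ex_derive _ _ _ _ _ _ _ (dF _ t0)).
rewrite (@ge0_continuous_FTC2y _ (@powR R ^~ (- q))
  ((1 - q)^-1 \*: (@powR R ^~ (1 - q))) _ 0).
- by rewrite -EFinB ltry.
- by move=> t _; exact: powR_ge0.
- apply/continuous_within_itvcyP; split.
    move=> t; rewrite in_itv/= andbT => t1; apply: continuous_powR_gt0.
    exact: lt_trans t1.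
  by apply: cvg_at_right_filter; exact: continuous_powR_gt0.
- rewrite -[0](scaler0 _ (1 - q)^-1); apply: cvgZr.
  by rewrite -[(1 - q)]opprB; apply: powRN_cvgy; rewrite subr_gt0.
- move=> t t1; apply: ex_derive; apply: dF; exact: lt_trans t1.
- by apply: cvg_at_right_filter; exact: cF.
- move=> t; rewrite in_itv/= andbT => t1; rewrite derive1E.
  by apply: derive_val; apply: dF; exact: lt_trans t1.
Qed.

End power_tail.

(** * Integrals over cylinders of functions of the height *)

Section vertical_integrals.
Local Open Scope ereal_scope.
Context {R : realType}.

Let measurable_id : measurable_fun setT (id : measurableTypeR R -> R).
Proof. by move=> _ A mA; rewrite setTI. Qed.

Let measurable_opp : measurable_fun setT (-%R : measurableTypeR R -> R).
Proof. exact: oppr_measurable. Qed.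

(** The measures differ only by the display of their domain; the identity, as a measurable map
    between the two, transports one to the other. *)
Lemma integral_lebesgue_line (J : set R) (f : R -> \bar R) :
  measurable J -> measurable_fun setT f -> (forall t, 0 <= f t) ->
  \int[@lebesgue_line R]_(t in J) f t = \int[lebesgue_measure]_(t in J) f t.
Proof.
move=> mJ mf f0.
rewrite -[RHS](@ge0_integral_pushforward _ _ _ _ _ _ measurable_id) => //.
exact: measurable_funTS.
Qed.

(** Lebesgue measure is invariant under reflection; this brings integrals over the lower end of a
    cylinder back to positive heights. *)
Lemma integral_lebesgue_lineN (J : set R) (f : R -> \bar R) :
  measurable J -> measurable_fun setT f -> (forall t, 0 <= f t) ->
  \int[@lebesgue_line R]_(t in J) f t =
  \int[lebesgue_measure]_(t in -%R @^-1` J) f (- t)%R.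
Proof.
move=> mJ mf f0.
rewrite -[RHS](@ge0_integral_pushforward _ _ _ _ _ _ measurable_opp) => //.
  by apply: eq_measure_integral => A mA _; exact/esym/lebesgue_measureN.
exact: measurable_funTS.
Qed.

Lemma integral_vertical n (U : set 'rV[R]_n) (J : set R) (f : R -> \bar R) :
  measurable U -> measurable J ->
  measurable_fun setT f -> (forall t, 0 <= f t) ->
  \int[lebesgue_space R n]_(X in U `*` J) f X.2 =
  lebesgue_row R n U * \int[@lebesgue_line R]_(t in J) f t.
Proof.
move=> mU mJ mf f0; rewrite integral_mkcond.
pose g := (fun X : 'rV[R]_n * R => f X.2) \_ (U `*` J).
have mUJ : measurable (U `*` J) by exact: measurableX.
have mg : measurable_fun setT g.
  apply/(measurable_restrictT _ _).1 => //.
  by apply: measurable_funTS; exact: measurableT_comp.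
have g0 X : 0 <= g X by rewrite /g patchE; case: ifP.
transitivity (\int[lebesgue_row R n]_x \int[@lebesgue_line R]_t g (x, t)).
  exact: (fubini_tonelli1 g mg g0).
have c0 : 0 <= \int[@lebesgue_line R]_(t in J) f t by exact: integral_ge0.
transitivity (\int[lebesgue_row R n]_(x in U) \int[@lebesgue_line R]_(t in J) f t).
  rewrite [RHS]integral_mkcond; apply: eq_integral => x _.
  rewrite [RHS]patchE; have [xU|xU] := boolP (x \in U).
    rewrite [RHS]integral_mkcond; apply: eq_integral => t _.
    by rewrite /g !patchE in_setX xU.
  by apply: integral0_eq => t _; rewrite /g patchE in_setX (negbTE xU).
by rewrite (integral_cst _ mU) muleC.
Qed.

Lemma integral_vertical_powR_lty n (U : set 'rV[R]_n) (J : set R) (q : R) :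
  measurable U -> lebesgue_row R n U < +oo -> (1 < q)%R -> measurable J ->
  J `<=` `[1%R, +oo[%classic \/ J `<=` `]-oo, (-1)%R]%classic ->
  \int[lebesgue_space R n]_(X in U `*` J) (`|X.2| `^ (- q))%:E < +oo.
Proof.
move=> mU Uoo q1 mJ HJ.
pose f := (fun t : R => (`|t| `^ (- q))%:E).
have mf : measurable_fun setT f.
  apply/measurable_EFinP; apply: (measurableT_comp (measurable_powR _)).
  exact: normr_measurable.
have f0 t : 0 <= f t by rewrite lee_fin powR_ge0.
rewrite (@integral_vertical _ _ _ f)//.
have c0 : 0 <= \int[@lebesgue_line R]_(t in J) f t by exact: integral_ge0.
apply: lte_mul_pinfty => //; first by rewrite ge0_fin_numE.
case: HJ => HJ; [rewrite integral_lebesgue_line//|rewrite integral_lebesgue_lineN//];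
  apply: le_lt_trans (integral_powR_lty q1);
  apply: le_integral_ae => //; try (by move=> t; rewrite lee_fin powR_ge0);
  apply: aeW => t Jt; have := HJ _ Jt; rewrite /= !in_itv/= ?andbT => t1.
  by split=> //; rewrite /f ger0_norm// (le_trans _ t1).
rewrite lerN2 in t1; split=> //.
by rewrite /f normrN ger0_norm// (le_trans _ t1).
Qed.

End vertical_integrals.

(** * Interaction between the two far ends of a cylinder *)

Section distant_interaction.
Context {R : realType} {n : nat}.

(** The heights have opposite signs, so |X - Y|^2 is at least (|X.2| + |Y.2|)^2, hence at least
    |X.2| |Y.2|; raising this to the power (n+1+s)/2 separates the variables. *)
Lemma kernel_le_vertical (s : R) (X Y : 'rV[R]_n * R) :
  (0 < s) -> (1 <= n)%N -> (X.2 <= -1) -> (1 <= Y.2) ->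
  ((dist_space X Y `^ (n.+1%:R + s))^-1 <=
   `|X.2| `^ (- ((n.+1%:R + s) / 2)) * `|Y.2| `^ (- ((n.+1%:R + s) / 2))).
Proof.
move=> s0 n1 X1 Y1; set q := ((n.+1%:R + s) / 2).
have q0 : (0 < q) by rewrite divr_gt0// addr_gt0.
have -> : (n.+1%:R + s = 2%:R * q) by rewrite mulrC divfK.
have XN : `|X.2| = (- X.2) by rewrite ler0_norm//; lra.
have YN : `|Y.2| = Y.2 by rewrite ger0_norm//; lra.
rewrite powRrM -powRM ?normr_ge0// powR_mulrn ?dist_space_ge0//.
rewrite XN YN powRN lef_pV2 ?posrE; last 2 first.
- rewrite powR_gt0// sqr_dist_space.
  apply: ltr_wpDl; first by apply: sumr_ge0 => i _; exact: sqr_ge0.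
  by rewrite exprn_even_gt0//= subr_eq0; apply/eqP; lra.
- by rewrite powR_gt0// mulr_gt0//; lra.
apply: ge0_ler_powR; rewrite ?nnegrE ?(ltW q0)// ?sqr_ge0//.
  by rewrite mulr_ge0//; lra.
rewrite sqr_dist_space.
apply: ler_wpDl; first by apply: sumr_ge0 => i _; exact: sqr_ge0.
nra.
Qed.

Local Open Scope ereal_scope.

(** Once the variables are separated, the double integral is at most a product of two tail integrals
    over a base of finite measure. *)
Lemma distant_interaction_lty (s : R) (U : set 'rV[R]_n) (k : R) :
  (0 < s)%R -> (1 <= n)%N -> (1 <= k)%R ->
  measurable U -> lebesgue_row R n U < +oo ->
  interaction s (U `*` `]-oo, (- k)%R]%classic) (U `*` `[k, +oo[%classic) < +oo.
Proof.
move=> s0 n1 k1 mU Uoo; set q := ((n.+1%:R + s) / 2)%R.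
(* From n >= 1 and s > 0, n + 1 + s > 2. *)
have q1 : (1 < q)%R.
  rewrite ltr_pdivlMr// mul1r (@le_lt_trans _ _ n.+1%:R)//.
    by rewrite ler_nat.
  by rewrite ltrDl.
pose h (X : 'rV[R]_n * R) := (`|X.2| `^ (- q))%:E.
have h0 X : 0 <= h X by rewrite lee_fin powR_ge0.
have mh : measurable_fun setT h.
  apply/measurable_EFinP; apply: (measurableT_comp (measurable_powR _)).
  by apply: measurableT_comp => //; exact: normr_measurable.
set A := U `*` _; set B := U `*` _.
have mA : measurable A by exact: measurableX.
have mB : measurable B by exact: measurableX.
have Aoo : \int[lebesgue_space R n]_(X in A) h X < +oo.
  apply: integral_vertical_powR_lty => //; right=> t/=.
  by rewrite !in_itv/= => /le_trans; apply; rewrite lerN2.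
have Boo : \int[lebesgue_space R n]_(X in B) h X < +oo.
  apply: integral_vertical_powR_lty => //; left=> t/=.
  by rewrite !in_itv/= !andbT; exact: le_trans.
apply: (@le_lt_trans _ _ (\int[lebesgue_space R n]_(X in A)
  (h X * \int[lebesgue_space R n]_(Y in B) h Y))); last first.
  rewrite ge0_integralZr//; last 2 first.
  - exact: measurable_funTS.
  - exact: integral_ge0.
  apply: lte_mul_pinfty => //; first exact: integral_ge0.
  by rewrite ge0_fin_numE//; exact: integral_ge0.
apply: le_integral_ae.
- by move=> X; apply: integral_ge0 => Y _; exact: kernel_ge0.
- by move=> X; apply: mule_ge0 => //; exact: integral_ge0.
apply: aeW => X AX; split=> //.
rewrite -ge0_integralZl//; last exact: measurable_funTS.
apply: le_integral_ae; [exact: kernel_ge0|by move=> Y; exact: mule_ge0|].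
apply: aeW => Y BY; split=> //; rewrite -EFinM lee_fin.
apply: kernel_le_vertical => //.
  by case: AX => _ /=; rewrite in_itv/= => /le_trans; apply; rewrite lerN2.
by case: BY => _ /=; rewrite in_itv/= andbT; exact: le_trans.
Qed.

End distant_interaction.

(** * Finiteness of the local perimeter in the infinite cylinder *)

Section infinite_cylinder.
Local Open Scope ereal_scope.
Context {R : realType} {n : nat} {s : R} {Omega : set 'rV[R]_n}.
Local Notation space := ('rV[R]_n * R)%type.
Local Notation mu := (lebesgue_space R n).

Hypothesis s01 : (0 < s < 1)%R.
Hypothesis n_gt0 : (1 <= n)%N.
Hypothesis Omega_bounded : bounded_set Omega.
Hypothesis Omega_open : open Omega.

Let mOmega : measurable Omega. Proof. exact: open_measurable_row. Qed.

Lemma lebesgue_space_setX (U : set 'rV[R]_n) (J : set R) :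
  measurable U -> measurable J ->
  mu (U `*` J) = lebesgue_row R n U * lebesgue_line J.
Proof. by move=> mU mJ; exact: product_measure1E. Qed.

Lemma perimeter_local_cylinder_lty (E : set space) (k : nat) :
  completion_measurable mu E ->
  ae_subset mu (Omega `*` `]-oo, (- k%:R)%R]%classic)
    (E `&` infinite_cylinder Omega) ->
  ae_subset mu (E `&` infinite_cylinder Omega) (Omega `*` `]-oo, k%:R]%classic) ->
  perimeter s E (cylinder Omega k.+1) < +oo ->
  perimeter_local s E (infinite_cylinder Omega) < +oo.
Proof.
rewrite /ae_subset => -[E0 mE0 EE0] lowE Eup.
rewrite /perimeter /perimeter_local /perimeter_nonlocal.
set I := infinite_cylinder Omega; set C := cylinder Omega k.+1.
(* [A] and [B] are the two ends that [C] leaves of the infinite cylinder. *)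
pose A : set space := Omega `*` `]-oo, (- k.+1%:R)%R]%classic.
pose B : set space := Omega `*` `[k.+1%:R, +oo[%classic; move=> Poo.
(* Even for [k = 0] the ends lie at heights of absolute value at least 1, as the decay estimate
   requires. *)
have k1 : (1 <= k.+1%:R :> R)%R by rewrite ler1n.
have mC : measurable C by apply: measurableX => //; exact: measurable_itv.
have mA : measurable A by exact: measurableX.
have mB : measurable B by exact: measurableX.
have mE0C : measurable (E0 `&` C) by exact: measurableI.
have mE0'C : measurable (~` E0 `&` C) by apply: measurableI => //; exact: measurableC.
have lty_le x y : x <= y -> y < +oo -> x < +oo by exact: le_lt_trans.
have [int1 int2 int3] : [/\ interaction s (E `&` C) (~` E `&` C) < +oo,
    interaction s (E `&` C) (~` E `\` C) < +oo &
    interaction s (E `\` C) (~` E `&` C) < +oo].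
  split; apply: lty_le Poo.
  - by rewrite leeDl// adde_ge0// interaction_ge0.
  - by rewrite addeCA leeDl// adde_ge0// interaction_ge0.
  - by rewrite addeA leeDr// adde_ge0// interaction_ge0.
(* Subadditivity is available for Borel sets only, so [E] is traded for [E0], with inclusions up to
   null sets. *)
have E0E : ae_subset mu (E0 `&` C) (E `&` C).
  by apply: filterS EE0 => X [_ h] [/h].
have E0'E : ae_subset mu (~` E0 `&` C) (~` E `&` C).
  by apply: filterS EE0 => X [h _] [h' XC]; split=> // /h.
have AE : ae_subset mu A (E `\` C).
  apply: filterS lowE => X h [OX /=]; rewrite in_itv/= => Xk; split.
    by apply: (h _).1; split=> //=; rewrite in_itv/=; lra.
  by move=> [_ /=]; rewrite in_itv/= => /andP[]; lra.
have BE : ae_subset mu B (~` E `\` C).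
  apply: filterS Eup => X h [OX /=]; rewrite in_itv/= andbT => Xk; split.
    by move=> EX; have [_ /=] := h (conj EX (conj OX Logic.I)); rewrite in_itv/=; lra.
  by move=> [_ /=]; rewrite in_itv/= => /andP[_]; lra.
(* Inside the infinite cylinder, [E] does not reach above height k, so outside [C] it can only meet
   [A]; likewise its complement can only meet [B]. *)
apply: (@le_lt_trans _ _ (interaction s (E0 `&` C `|` A) (~` E0 `&` C `|` B))).
  apply: le_interaction_ae.
    rewrite /ae_subset; near=> X => -[EX [OX _]].
    have [kX|kX] := leP X.2 (- k.+1%:R)%R; [right|left].
      by split=> //=; rewrite in_itv.
    split; first by apply/(near EE0 X).
    have [_ /=] : (Omega `*` `]-oo, k%:R]%classic) X.
      exact: (near Eup X).
    rewrite in_itv/= => Xk; split=> //=; rewrite in_itv/= kX/=; lra.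
  rewrite /ae_subset; near=> X => -[E'X [OX _]].
  have [kX|kX] := leP k.+1%:R X.2; [right|left].
    by split=> //=; rewrite in_itv/= kX.
  split; first by move=> E0X; apply: E'X; apply/(near EE0 X).
  split=> //=; rewrite in_itv/= kX andbT ltNge; apply/negP => Xk.
  apply: E'X; have [] // : (E `&` I) X.
  by apply: (near lowE X) => //; split=> //=; rewrite in_itv/=; lra.
have mU1 : measurable (~` E0 `&` C `|` B) by exact: measurableU.
(* Of the four resulting interactions, three are bounded by the terms of the perimeter in [C]; the
   fourth joins [A] to [B]. *)
apply: le_lt_trans (interaction_setUl _ _ _) _ => //.
apply: lte_add_pinfty; apply: le_lt_trans (interaction_setUr _ _ _) _ => //;
  apply: lte_add_pinfty.
- by apply: le_lt_trans int1; exact: le_interaction_ae.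
- by apply: le_lt_trans int2; exact: le_interaction_ae.
- by apply: le_lt_trans int3; exact: le_interaction_ae.
apply: distant_interaction_lty => //; first by case/andP: s01.
exact: lebesgue_row_bounded_lty.
Unshelve. all: by end_near. Qed.

(** * Divergence of the nonlocal perimeter in the infinite cylinder *)

Lemma le_dist_space (X Y : space) (T : R) : (0 <= T)%R ->
  (forall i, `|X.1 ord0 i - Y.1 ord0 i| <= T)%R ->
  (`|X.2 - Y.2| <= T)%R -> (dist_space X Y <= n.+1%:R * T)%R.
Proof.
move=> T0 XY1 XY2.
rewrite -(@ler_pXn2r _ 2)// ?nnegrE ?dist_space_ge0 ?mulr_ge0//.
have sqr_le (a : R) : (`|a| <= T)%R -> (a ^+ 2 <= T ^+ 2)%R.
  by move=> aT; rewrite -[(a ^+ 2)%R]real_normK ?num_real// lerXn2r// nnegrE.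
rewrite sqr_dist_space exprMn.
apply: (@le_trans _ _ (n.+1%:R * T ^+ 2)%R).
  rewrite -natr1 mulrDl mul1r lerD ?sqr_le//.
  rewrite (le_trans (ler_sum _ (fun i _ => sqr_le _ (XY1 i))))//.
  by rewrite sumr_const card_ord mulr_natl.
(* A factor n+1 is given away to avoid a square root in the bound. *)
by rewrite ler_wpM2r ?sqr_ge0// expr2 ler_peMl// ler1n.
Qed.

(** At scale [T], the part of [S] in [E] interacts with [B], which lies above [E], and the rest of
    [S] with [B'], which lies in [E]. The volumes |Omega| T of [S] and T^(n+1) of each slab give the
    power T^(n+2). *)
Lemma perimeter_nonlocal_ge (E : set space) (kappa M T : R) :
  completion_measurable mu E ->
  {ae mu, forall X, ~ Omega X.1 -> (X.2 <= - kappa)%R -> E X} ->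
  {ae mu, forall X, ~ Omega X.1 -> E X -> (X.2 <= kappa)%R} ->
  (0 < M)%R -> Omega `<=` ball (0 : 'rV[R]_n)%R M ->
  (0 < T)%R -> (kappa <= T)%R -> (2 * M <= T)%R ->
  (((n.+1%:R * (4 * T)) `^ (n.+1%:R + s))^-1 * (T ^+ n.+2))%:E *
    lebesgue_row R n Omega <=
  perimeter_nonlocal s E (infinite_cylinder Omega).
Proof.
move=> [E0 mE0 EE0] lowE Eup M0 OM T0 kT MT.
set I := infinite_cylinder Omega; set c := ((_ `^ _)^-1)%R.
(* Q is a cube of side T off Omega, the slabs B and B' stay at vertical distance
   at least T from S, so that the kernel is bounded below by c. *)
pose Q := [set x : 'rV[R]_n | forall i, `]M, (M + T)%R[%classic (x ord0 i)].
have mQ : measurable Q.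
  by apply: (measurable_row_box (J := fun=> `]M, (M + T)%R[%classic)) => i.
have OME x i : Omega x -> (- M < x ord0 i < M)%R.
  by move=> /OM; rewrite ball_row_box// => /(_ i)/=; rewrite mxE in_itv/= sub0r add0r.
(* One coordinate beyond [M] suffices to leave [Omega], and n >= 1 provides one. *)
have QO x : Q x -> ~ Omega x.
  move=> /(_ (Ordinal n_gt0))/=; rewrite in_itv/= => /andP[Mx _].
  by move=> /(OME x (Ordinal n_gt0))/andP[_]; rewrite ltNge ltW.
pose slab (U : set 'rV[R]_n) (a : R) : set space :=
  U `*` `]a, (a + T)%R[%classic.
have mslab U a : measurable U -> measurable (slab U a).
  by move=> mU; exact: measurableX.
have slabE U a : measurable U -> mu (slab U a) = lebesgue_row R n U * T%:E.
  move=> mU; rewrite lebesgue_space_setX//; congr (_ * _).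
  rewrite /lebesgue_line lebesgue_measure_itv/= lte_fin ltrDl T0.
  by rewrite -EFinB addrAC subrr add0r.
have QE : lebesgue_row R n Q = (T ^+ n)%:E.
  exact: (lebesgue_row_cube (a := fun=> M) (b := fun=> (M + T)%R)).
pose S := slab Omega (- (2 * T))%R.
have mS : measurable S by exact: mslab.
pose A := S `&` E0; pose A' := S `\` E0.
have mA : measurable A by exact: measurableI.
have mA' : measurable A' by exact: measurableD.
pose B := slab Q T; pose B' := slab Q (- (4 * T))%R.
have mB : measurable B by exact: mslab.
have mB' : measurable B' by exact: mslab.
have p0 : (0 <= n.+1%:R + s)%R.
  by rewrite addr_ge0// ltW//; case/andP: s01.
have dist X Y a : S X -> slab Q a Y ->
    (a = T \/ a = - (4 * T))%R ->
    (0 < dist_space X Y <= n.+1%:R * (4 * T))%R.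
  move=> [OX /=]; rewrite in_itv/= => /andP[X1 X2] [QY /=].
  rewrite in_itv/= => /andP[Y1 Y2] aE.
  (* The heights lie in ]-2T, -T[ for [S], in ]T, 2T[ for [B] and in ]-4T, -3T[ for [B']. *)
  have XYT : (T <= `|X.2 - Y.2| <= 4 * T)%R.
    case: aE Y1 Y2 => -> Y1 Y2.
      by rewrite ler0_norm; [|lra]; apply/andP; split; lra.
    by rewrite ger0_norm; [|lra]; apply/andP; split; lra.
  have /andP[XYT1 XYT2] := XYT.
  apply/andP; split; last first.
    apply: le_dist_space => //; first by rewrite mulr_ge0// ltW.
    (* Horizontal coordinates differ by less than 2M + T, which is at most 2T. *)
    move=> i; have /andP[? ?] := OME X.1 i OX.
    have /= := QY i; rewrite in_itv/= => /andP[? ?].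
    by rewrite ler_norml; apply/andP; split; lra.
  rewrite sqrtr_gt0 ltr_wpDl//.
    by apply: sumr_ge0 => i _; exact: sqr_ge0.
  by rewrite -[((_ - _) ^+ 2)%R]real_normK ?num_real// exprn_gt0// (lt_le_trans T0).
have intAB : c%:E * (mu A * mu B) <= interaction s (E `&` I) (~` E `\` I).
  apply: (@le_trans _ _ (interaction s A B)).
    by apply: interaction_ge => // X Y [SX _] BY; apply: (dist X Y T); auto.
  apply: le_interaction_ae; rewrite /ae_subset.
    by apply: filterS EE0 => X [_ h] [[OX _] /h EX].
  apply: filterS Eup => X h [QX /=]; rewrite in_itv/= => /andP[TX _].
  split; last by move=> [/(QO _ QX)].
  by move=> /(h (QO _ QX)); lra.
have intBA : c%:E * (mu B' * mu A') <= interaction s (E `\` I) (~` E `&` I).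
  apply: (@le_trans _ _ (interaction s B' A')).
    apply: interaction_ge => // X Y BX [SY _].
    have -> : dist_space X Y = dist_space Y X.
      rewrite /dist_space; congr (Num.sqrt (_ + _)); last first.
        by rewrite -sqrrN opprB.
      by apply: eq_bigr => i _; rewrite -sqrrN opprB.
    by apply: (dist Y X (- (4 * T))%R); auto.
  apply: le_interaction_ae; rewrite /ae_subset.
    apply: filterS lowE => X h [QX /=]; rewrite in_itv/= => /andP[_ XT].
    split; last by move=> [/(QO _ QX)].
    by apply: (h (QO _ QX)); lra.
  by apply: filterS EE0 => X [h _] [[OX _] h']; split=> // /h.
apply: le_trans (leeD intAB intBA).
rewrite (slabE _ _ mQ) (slabE _ _ mQ) QE.
have c0 : (0 <= c)%R by rewrite invr_ge0 powR_ge0.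
(* The two bounds add up to one for all of [S], and the dependence on [E] disappears. *)
have SE : mu S = mu A' + mu A by rewrite (measureDI mu mS mE0).
rewrite -EFinM [_%:E * mu A']muleC -ge0_muleDr ?mule_ge0//; last 2 first.
- by rewrite lee_fin mulr_ge0// ?exprn_ge0// ltW.
- by rewrite lee_fin mulr_ge0// ?exprn_ge0// ltW.
rewrite -ge0_muleDl// [mu A + _]addeC -SE slabE//.
by rewrite -muleA -EFinM -exprSr -exprS EFinM -muleA [lebesgue_row _ _ _ * _]muleC.
Qed.

(** A finite value [K] would bound d T^(1-s) for all large [T], which is absurd since s < 1. *)
Lemma perimeter_nonlocal_pinfty (E : set space) (kappa : R) :
  Omega !=set0 -> completion_measurable mu E ->
  {ae mu, forall X, ~ Omega X.1 -> (X.2 <= - kappa)%R -> E X} ->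
  {ae mu, forall X, ~ Omega X.1 -> E X -> (X.2 <= kappa)%R} ->
  perimeter_nonlocal s E (infinite_cylinder Omega) = +oo.
Proof.
move=> Omega0 mE lowE Eup.
have [M M0 OM] := bounded_set_row_ball Omega_bounded.
have w_gt0 : 0 < lebesgue_row R n Omega by exact: lebesgue_row_open_gt0.
have w_fin : lebesgue_row R n Omega \is a fin_num.
  by rewrite ge0_fin_numE// lebesgue_row_bounded_lty.
set P := perimeter_nonlocal _ _ _.
have [s0 s1] := andP s01.
have P0 : 0 <= P by apply: adde_ge0; exact: interaction_ge0.
apply/eqP; rewrite eq_le leey/= leNgt; apply/negP => Poo.
pose K := fine P.
have PK : P = K%:E by rewrite fineK// ge0_fin_numE.
have K0 : (0 <= K)%R by rewrite fine_ge0.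
pose p := (n.+1%:R + s)%R.
(* [d] collects the factors of the lower bound that do not depend on [T]. *)
pose d := (((n.+1%:R * 4) `^ p)^-1 * fine (lebesgue_row R n Omega))%R.
have d0 : (0 < d)%R.
  by rewrite mulr_gt0 ?invr_gt0 ?powR_gt0 ?mulr_gt0// fine_gt0// w_gt0 -ge0_fin_numE.
have growth T : (0 < T)%R -> (kappa <= T)%R -> (2 * M <= T)%R ->
    (d * T `^ (1 - s) <= K)%R.
  move=> T0 kT MT; rewrite -lee_fin -PK.
  apply: le_trans (perimeter_nonlocal_ge mE lowE Eup M0 OM T0 kT MT).
  rewrite -[lebesgue_row _ _ _]fineK// -EFinM lee_fin.
  rewrite mulrA powRM ?mulr_ge0 ?(ltW T0)// -/p invfM.
  have -> : (T `^ (1 - s) = (T `^ p)^-1 * T ^+ n.+2)%R.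
    rewrite -powRN -powR_mulrn ?(ltW T0)// -powRD; last first.
      by rewrite (gt_eqF T0) implybT.
    by congr (_ `^ _)%R; rewrite /p -[n.+2%:R]natr1; ring.
  by rewrite /d le_eqVlt; apply/orP; left; apply/eqP; ring.
(* Chosen so that d T1^(1-s) = K + d > K. *)
pose T1 := ((K / d + 1) `^ (1 - s)^-1)%R.
pose T := Num.max T1 (Num.max kappa (2 * M))%R.
have T_ge0 : (2 * M <= T)%R by rewrite !le_max lexx !orbT.
have T0 : (0 < T)%R by apply: lt_le_trans T_ge0; rewrite mulr_gt0.
have := growth T T0; rewrite !le_max !lexx !orbT => /(_ isT isT).
apply/negP; rewrite -ltNge.
apply: (@lt_le_trans _ _ (d * T1 `^ (1 - s))%R).
  rewrite /T1 -powRrM mulVf ?powRr1 ?addr_ge0 ?divr_ge0 ?(ltW d0)//.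
    by rewrite mulrDr mulr1 mulrCA divff ?gt_eqF// mulr1 ltrDl.
  by rewrite subr_eq0 gt_eqF.
rewrite ler_wpM2l ?(ltW d0)// ge0_ler_powR ?nnegrE ?powR_ge0 ?(ltW T0)//.
  by rewrite subr_ge0 ltW.
by rewrite le_max lexx.
Qed.

End infinite_cylinder.

(** * Bounded exterior data, and the three assertions *)

Lemma ae_lebesgue_space_row {R : realType} n (P : 'rV[R]_n -> Prop) :
  {ae lebesgue_row R n, forall x, P x} ->
  {ae lebesgue_space R n, forall X, P X.1}.
Proof.
move=> [N [mN N0 PN]]; exists (N `*` setT); split.
- exact: measurableX.
(* The vertical line has infinite measure; the convention 0 * oo = 0 applies. *)
- by rewrite lebesgue_space_setX// N0 mul0e.
- by move=> X /= PX; split=> //; exact: PN.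
Qed.

Lemma Linfty_ae_bounded {R : realType} n (v : 'rV[R]_n -> R) : Linfty v ->
  exists M : R, {ae lebesgue_row R n, forall x, `|v x| <= M}.
Proof.
move=> [_]; set e := ess_sup _ _ => eoo.
have [M eM] : exists M : R, (e <= M%:E)%E.
  (* An essential supremum equal to -oo has to be covered too; 0 bounds it. *)
  by case: e eoo => [M||] // _; [exists M|exists 0; rewrite leNye].
by exists M; move/ess_supP : eM; apply: filterS => x; rewrite lee_fin.
Qed.

Unset Implicit Arguments.

Theorem theorem1p13 (R : realType) (s : R) (n : nat) (Omega : set 'rV[R]_n) :
  0 < s < 1 -> (1 <= n)%N ->
  Omega !=set0 -> bounded_set Omega -> open Omega ->
  [/\ (forall (E : set ('rV[R]_n * R)) (k : nat),
         completion_measurable (lebesgue_space R n) E ->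
         ae_subset (lebesgue_space R n)
           (Omega `*` `]-oo, - k%:R]%classic) (E `&` infinite_cylinder Omega) ->
         ae_subset (lebesgue_space R n)
           (E `&` infinite_cylinder Omega) (Omega `*` `]-oo, k%:R]%classic) ->
         (perimeter s E (cylinder Omega k.+1) < +oo)%E ->
         (perimeter_local s E (infinite_cylinder Omega) < +oo)%E),
      (forall (E : set ('rV[R]_n * R)) (k : nat),
         completion_measurable (lebesgue_space R n) E ->
         ae_subset (lebesgue_space R n)
           [set X | X.2 <= - k%:R] E ->
         ae_subset (lebesgue_space R n)
           E [set X | X.2 <= k%:R] ->
         perimeter_nonlocal s E (infinite_cylinder Omega) = +oo%E) &
      (forall v : 'rV[R]_n -> R,
         C11_boundary Omega -> Linfty v ->
         ~ exists E : set ('rV[R]_n * R),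
             [/\ completion_measurable (lebesgue_space R n) E,
                 s_minimal s E (infinite_cylinder Omega) &
                 ae_eqset (lebesgue_space R n)
                   (E `\` infinite_cylinder Omega)
                   [set X | ~ Omega X.1 /\ X.2 < v X.1]])].
Proof.
move=> s01 n1 Omega0 bOmega oOmega; split=> [E k|E k mE|v _ /Linfty_ae_bounded[M vM]].
- exact: perimeter_local_cylinder_lty.
- rewrite /ae_subset => lowE Eup.
  apply: (perimeter_nonlocal_pinfty s01 n1 bOmega oOmega (kappa := k%:R)) => //.
    by apply: filterS lowE => X h _; exact: h.
  by apply: filterS Eup => X h _; exact: h.
rewrite /ae_eqset => -[E [mE [perE _] EvE]].
(* A minimal set has finite perimeter by definition, so an infinite nonlocal part is already a
   contradiction. *)
suff NLoo : perimeter_nonlocal s E (infinite_cylinder Omega) = +oo%E.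
  move: perE; rewrite /perimeter NLoo addey ?ltxx// gt_eqF//.
  by rewrite (lt_le_trans _ (interaction_ge0 _ _)).
have vM' := ae_lebesgue_space_row vM.
(* The exterior data is a strict subgraph, so height -M itself may fall outside [E]; the extra 1
   gives strict inequalities. *)
apply: (perimeter_nonlocal_pinfty s01 n1 bOmega oOmega (kappa := M + 1)) => //.
  apply: filterS2 vM' EvE => X /= vXM [_ h] OX XM.
  have [] // : (E `\` infinite_cylinder Omega) X.
  by apply: h; split=> //; move: vXM; rewrite ler_norml => /andP[]; lra.
apply: filterS2 vM' EvE => X /= vXM [h _] OX EX.
have [|_] := h; first by split=> // -[].
by move: vXM; rewrite ler_norml => /andP[]; lra.
Qed.
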